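(* (Transversality Mapping Principle, TMP.) The first-order necessary conditions for Problem $(N)$ are imbedded in the terminal transversality conditions for Problem $(M)$.
   Context: Let $E:\mathbb{R}^{N_x}\to\mathbb{R}$ and $e:\mathbb{R}^{N_x}\to\mathbb{R}^{N_e}$ be given functions, let $e^L,e^U\in\mathbb{R}^{N_e}$ be specified lower and upper bounds on the values of $e$, and let $(x^0,t^0)\in\mathbb{R}^{N_x}\times\mathbb{R}$ be a given initial point. The symbol $\partial_x$ denotes the derivative in $x$ (gradient of $E$, Jacobian of $e$). Problem $(N)$: minimize $E(x_f)$ over $x_f\in C=\{x\in\mathbb{R}^{N_x}: e^L\le e(x)\le e^U\}$. Its Lagrangian is $L(\nu^0_f,\nu_f,x_f):=\nu^0_fE(x_f)+\nu_f\cdot e(x_f)$, where $(\nu^0_f,\nu_f)\in\mathbb{R}_+\times\mathbb{R}^{N_e}$ is the Fritz John multiplier pair. The complementarity condition $\nu_f\dagger e(x_f)$ means that, for $i=1,\dots,N_e$: $\nu_i\le0$ if $e_i(x_f)=e_i^L$; $\nu_i=0$ if $e_i^L<e_i(x_f)<e_i^U$; $\nu_i\ge0$ if $e_i(x_f)=e_i^U$; $\nu_i$ is unrestricted if $e_i^L=e_i^U$. The first-order necessary conditions for $(N)$ are $0=\partial_xL(\nu^0_f,\nu_f,x_f)$ together with $\nu_f\dagger e(x_f)$. Problem $(M)$ is the following time-free optimal control problem: minimize $J[x(\cdot),v(\cdot),y(\cdot),s(\cdot),u(\cdot),t_f]:=y(t_f)$ subject to $\dot x=v$, $\dot v=u$,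 $\dot y=[\partial_xE(x)]\cdot v$, $\dot s=[\partial_xe(x)]\,v$, $(x(t_0),t_0)=(x^0,t^0)$, $(y(t_0),s(t_0))=(E(x^0),e(x^0))$, $v(t_f)=0$, $e^L\le s(t_f)\le e^U$. Here $x(t),v(t),u(t)\in\mathbb{R}^{N_x}$, $y(t)\in\mathbb{R}$, $s(t)\in\mathbb{R}^{N_e}$; $u$ is the unconstrained control, and $v(t_0)$ is not prescribed. The Pontryagin Hamiltonian for $(M)$ is $H:=\lambda_x\cdot v+\lambda_v\cdot u+\lambda_y[\partial_xE(x)]\cdot v+\lambda_s\cdot[\partial_xe(x)]v$, where $\lambda_x,\lambda_v,\lambda_y,\lambda_s$ are the adjoint covectors corresponding to $x,v,y,s$. They satisfy the adjoint equations $\dot\lambda_x=-\partial_xH$, $\dot\lambda_v=-\partial_vH$, $\dot\lambda_y=-\partial_yH$, $\dot\lambda_s=-\partial_sH$, and the Hamiltonian minimization condition gives $\partial_uH=0$ for all $t\in[t_0,t_f]$. The terminal transversality conditions for $(M)$ are $\lambda_x(t_f)=0$, $\lambda_v(t_f)=\nu_v$, $\lambda_y(t_f)=\nu_0\ge0$, $\lambda_s(t_f)=\nu_s$. Here $\nu_0\ge0$ is the cost multiplier, $\nu_v\in\mathbb{R}^{N_x}$ is the multiplier for $v(t_f)=0$, and $\nu_s\in\mathbb{R}^{N_e}$ is the multiplier for the bounds on $s(t_f)$, satisfying the complementarity condition $\nu_s\dagger s(t_f)$: for each $i$, $\nu_{s,i}\le0$ if $s_i(t_f)=e_i^L$; $\nu_{s,i}=0$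 if $e_i^L<s_i(t_f)<e_i^U$; $\nu_{s,i}\ge0$ if $s_i(t_f)=e_i^U$; $\nu_{s,i}$ is unrestricted if $e_i^L=e_i^U$. *)

(* Defs.v *)
From HB Require Import structures.
From mathcomp Require Import all_boot all_order all_algebra.
From mathcomp Require Import all_classical all_reals all_analysis.

Set Implicit Arguments.
Unset Strict Implicit.
Unset Printing Implicit Defensive.

Import Order.TTheory GRing.Theory Num.Theory.
Import numFieldNormedType.Exports.

Local Open Scope classical_set_scope.
Local Open Scope ring_scope.

(* Vectors and covectors are both row vectors.  With this convention the
   library's Jacobian is the transpose of the usual one: its (i, j) entry is the
   i-th partial derivative of e_j, and [d_x e(x)] v is v *m 'J e x. *)

Definition dot (R : realType) (n : nat) (p q : 'rV[R]_n) : R :=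
  \sum_(i < n) p ord0 i * q ord0 i.

Definition grad (R : realType) (n : nat) (f : 'rV[R]_n -> R) (x : 'rV[R]_n) :
    'rV[R]_n :=
  \row_(i < n) 'D_(delta_mx ord0 i) f x.

(* Twice differentiability of the data, so that d_x H below exists. *)
Definition twice_diff_fun (R : realType) (n : nat) (E : 'rV[R]_n -> R) : Prop :=
  forall x, differentiable E x /\ differentiable (grad E) x.

Definition twice_diff_map (R : realType) (n m : nat)
    (e : 'rV[R]_n -> 'rV[R]_m) : Prop :=
  forall x, differentiable e x /\ differentiable (jacobian e) x.

(* The differential equation f' = g on [a, b] in the sense of Caratheodory:
   f is absolutely continuous on [a, b] and f' = g almost everywhere there. *)
Definition ode (R : realType) (a b : R) (f g : R -> R) : Prop :=
  (@lebesgue_measure R).-integrable `[a, b] (EFin \o g) /\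
  forall t, t \in `[a, b] ->
    f t = f a + \int[@lebesgue_measure R]_(r in `[a, t]) g r.

Definition ode_row (R : realType) (n : nat) (a b : R) (f g : R -> 'rV[R]_n) :
    Prop :=
  forall i, ode a b (fun t => f t ord0 i) (fun t => g t ord0 i).

Definition between (R : realType) (m : nat) (eL eU w : 'rV[R]_m) : Prop :=
  forall i, eL ord0 i <= w ord0 i <= eU ord0 i.

(* nu is a multiplier complementary to the value w of a quantity with bounds
   eL, eU; no condition is imposed on nu_i when eL_i = eU_i. *)
Definition complementary (R : realType) (m : nat) (eL eU nu w : 'rV[R]_m) :
    Prop :=
  forall i, eL ord0 i <> eU ord0 i ->
    [/\ w ord0 i = eL ord0 i -> nu ord0 i <= 0,
        eL ord0 i < w ord0 i < eU ord0 i -> nu ord0 i = 0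
      & w ord0 i = eU ord0 i -> 0 <= nu ord0 i].

Section ProblemN.
Context (R : realType) (Nx Ne : nat).
Variables (E : 'rV[R]_Nx -> R) (e : 'rV[R]_Nx -> 'rV[R]_Ne).
Variables (eL eU : 'rV[R]_Ne).

Definition lagrangianN (nu0 : R) (nu : 'rV[R]_Ne) (x : 'rV[R]_Nx) : R :=
  nu0 * E x + dot nu (e x).

Definition first_order_N (nu0 : R) (nu : 'rV[R]_Ne) (xf : 'rV[R]_Nx) : Prop :=
  [/\ between eL eU (e xf),
      0 <= nu0,
      grad (lagrangianN nu0 nu) xf = 0
    & complementary eL eU nu (e xf)].

End ProblemN.

Record process (R : realType) (Nx Ne : nat) := Process {
  px : R -> 'rV[R]_Nx;
  pv : R -> 'rV[R]_Nx;
  py : R -> R;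
  ps : R -> 'rV[R]_Ne;
  pu : R -> 'rV[R]_Nx;
  tf : R
}.

Record costate (R : realType) (Nx Ne : nat) := Costate {
  lx : R -> 'rV[R]_Nx;
  lv : R -> 'rV[R]_Nx;
  ly : R -> R;
  ls : R -> 'rV[R]_Ne
}.

Section ProblemM.
Context (R : realType) (Nx Ne : nat).
Variables (E : 'rV[R]_Nx -> R) (e : 'rV[R]_Nx -> 'rV[R]_Ne).
Variables (eL eU : 'rV[R]_Ne) (x0 : 'rV[R]_Nx) (t0 : R).

Definition dynamics_M (p : process R Nx Ne) : Prop :=
  [/\ ode_row t0 (tf p) (px p) (pv p),
      ode_row t0 (tf p) (pv p) (pu p),
      ode t0 (tf p) (py p) (fun t => dot (grad E (px p t)) (pv p t))
    & ode_row t0 (tf p) (ps p) (fun t => pv p t *m jacobian e (px p t))].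

Definition feasible_M (p : process R Nx Ne) : Prop :=
  [/\ t0 < tf p,
      dynamics_M p,
      [/\ px p t0 = x0, py p t0 = E x0 & ps p t0 = e x0],
      pv p (tf p) = 0
    & between eL eU (ps p (tf p))].

Definition hamiltonian (lamx lamv : 'rV[R]_Nx) (lamy : R)
    (lams : 'rV[R]_Ne) (x v : 'rV[R]_Nx) (y : R) (s : 'rV[R]_Ne)
    (u : 'rV[R]_Nx) : R :=
  dot lamx v + dot lamv u + lamy * dot (grad E x) v
  + dot lams (v *m jacobian e x).

Section Along.
Variables (p : process R Nx Ne) (l : costate R Nx Ne).

Let H (t : R) := hamiltonian (lx l t) (lv l t) (ly l t) (ls l t).

Definition dHx (t : R) : 'rV[R]_Nx :=
  grad (fun z => H t z (pv p t) (py p t) (ps p t) (pu p t)) (px p t).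
Definition dHv (t : R) : 'rV[R]_Nx :=
  grad (fun z => H t (px p t) z (py p t) (ps p t) (pu p t)) (pv p t).
Definition dHy (t : R) : R :=
  derive1 (fun z => H t (px p t) (pv p t) z (ps p t) (pu p t)) (py p t).
Definition dHs (t : R) : 'rV[R]_Ne :=
  grad (fun z => H t (px p t) (pv p t) (py p t) z (pu p t)) (ps p t).
Definition dHu (t : R) : 'rV[R]_Nx :=
  grad (fun z => H t (px p t) (pv p t) (py p t) (ps p t) z) (pu p t).

Definition adjoint_M : Prop :=
  [/\ ode_row t0 (tf p) (lx l) (fun t => - dHx t),
      ode_row t0 (tf p) (lv l) (fun t => - dHv t),
      ode t0 (tf p) (ly l) (fun t => - dHy t)
    & ode_row t0 (tf p) (ls l) (fun t => - dHs t)].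

Definition hamiltonian_stationary_M : Prop :=
  forall t, t \in `[t0, tf p] -> dHu t = 0.

Definition transversality_M (nu0 : R) (nuv : 'rV[R]_Nx) (nus : 'rV[R]_Ne) :
    Prop :=
  [/\ lx l (tf p) = 0,
      lv l (tf p) = nuv,
      ly l (tf p) = nu0 /\ 0 <= nu0,
      ls l (tf p) = nus
    & complementary eL eU nus (ps p (tf p))].

End Along.
End ProblemM.

(* Main.v *)
Require Import Defs.
From HB Require Import structures.
From mathcomp Require Import all_boot all_order all_algebra.
From mathcomp Require Import all_classical all_reals all_analysis.

Set Implicit Arguments.
Unset Strict Implicit.
Unset Printing Implicit Defensive.

Import Order.TTheory GRing.Theory Num.Theory.
Import numFieldNormedType.Exports.

Local Open Scope classical_set_scope.
Local Open Scope ring_scope.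

(** The velocity adjoint is what carries the stationarity of the Lagrangian.
    Stationarity of the Hamiltonian in the unconstrained control says
    [lambda_v = 0] on the whole of [[t0, tf]] ([dHuE]).  The adjoint equation
    then has a zero solution, and its right-hand side [- d_v H] vanishes up to
    the final time, since
      [d_v H = lambda_x + lambda_y *: grad E x + lambda_s *m ('J e x)^T]
    is continuous along the extremal ([dHvE], [dHv_tf_eq0]).  At the final time
    transversality gives [lambda_x = 0], [lambda_y = nu0] and
    [lambda_s = nus]; what is left of [d_v H = 0] is exactly
      [nu0 *: grad E xf + nus *m ('J e xf)^T = 0],
    and the left-hand side is the gradient of the Lagrangian
    ([grad_lagrangian]).

    The remaining conditions of Problem (N) concern [e xf], whereas those of
    Problem (M) concern the auxiliary state [s] at the final time.  The two
    values agree ([ps_tfE]): [v] is absolutely continuous, so [x] is C^1 and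
    [e \o x] solves the same differential equation as [s], from the same
    initial value.

    The differential equations hold only in integral form.  Every one that is
    used pointwise has a continuous right-hand side, and the fundamental theorem
    of calculus then makes its solution differentiable in the interior
    ([ode_is_derive]); endpoint values are reached by continuity. *)

(** * Limits and derivatives of matrix-valued functions *)

Lemma mx_cvg (R : realType) (m n : nat) (T : Type) (F : set_system T)
    (FF : Filter F) (f : T -> 'M[R]_(m, n)) (a : 'M[R]_(m, n)) :
  f x @[x --> F] --> a <-> forall i j, f x i j @[x --> F] --> a i j.
Proof.
split=> [fa i j|fa].
  apply: (cvg_comp f (fun M : 'M[R]_(m, n) => M i j) fa).
  exact: coord_continuous.
rewrite [a]matrix_sum_delta.
have -> : f = fun x => \sum_i \sum_j f x i j *: delta_mx i j.
  by apply/funext => x; exact: matrix_sum_delta.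
apply: (cvg_big (op := +%R) add_continuous) => i _.
by apply: (cvg_big (op := +%R) add_continuous) => j _; exact: cvgZr_tmp.
Qed.

Lemma row_cvg (R : realType) (n : nat) (T : Type) (F : set_system T)
    (FF : Filter F) (f : T -> 'rV[R]_n) (a : 'rV[R]_n) :
  f x @[x --> F] --> a <-> forall i, f x ord0 i @[x --> F] --> a ord0 i.
Proof.
rewrite mx_cvg; split=> [fa i|fa i j]; first exact: fa.
by rewrite (ord1 i); exact: fa.
Qed.

Lemma trmx_continuous (R : realType) (m n : nat) : continuous (@trmx R m n).
Proof.
move=> M; apply/(mx_cvg (nbhs_filter M)) => i j; rewrite mxE.
by under eq_fun do rewrite mxE; exact: coord_continuous.
Qed.

Lemma cvg_mulmx (R : realType) (n k : nat) (T : Type) (F : set_system T)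
    (FF : Filter F) (f : T -> 'rV[R]_n) (M : T -> 'M[R]_(n, k))
    (a : 'rV[R]_n) (A : 'M[R]_(n, k)) :
  f x @[x --> F] --> a -> M x @[x --> F] --> A ->
  f x *m M x @[x --> F] --> a *m A.
Proof.
move=> fa MA; apply/row_cvg => j; rewrite mxE.
under eq_fun do rewrite mxE.
apply: (cvg_big (op := +%R) add_continuous) => i _; apply: cvgM.
  exact: (row_cvg _ _ _).1.
exact: (mx_cvg _ _ _).1.
Qed.

Lemma within_comp (R : realType) (U V : topologicalType) (A : set R)
    (f : R -> U) (g : U -> V) :
  {within A, continuous f} -> continuous g -> {within A, continuous (g \o f)}.
Proof. by move=> cf cg t; exact: (continuous_comp (cf t) (cg (f t))). Qed.

Lemma is_deriveP_cvg (R : realType) (V W : normedModType R) (f : V -> W)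
    (x v : V) (df : W) :
  is_derive x v f df <->
  h^-1 *: (f (h *: v + x) - f x) @[h --> 0^'] --> df.
Proof.
split=> [[fx <-]|fx]; first exact: fx.
by split; [exact: (cvgP df)|exact: cvg_lim].
Qed.

Lemma is_derive_row (R : realType) (n : nat) (V : normedModType R)
    (f : V -> 'rV[R]_n) (x v : V) (df : 'rV[R]_n) :
  is_derive x v f df <->
  forall i, is_derive x v (fun y => f y ord0 i) (df ord0 i).
Proof.
have quotE i : (fun h => (h^-1 *: (f (h *: v + x) - f x)) ord0 i) =
    fun h => h^-1 *: (f (h *: v + x) ord0 i - f x ord0 i).
  by apply/funext => h; rewrite !mxE.
split=> [/is_deriveP_cvg/row_cvg fx i|fx].
  by apply/is_deriveP_cvg; have := fx i; rewrite quotE.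
by apply/is_deriveP_cvg/row_cvg => i; rewrite quotE; exact/is_deriveP_cvg.
Qed.

Lemma is_derive_dot (R : realType) (n : nat) (V : normedModType R)
    (q : 'rV[R]_n) (f : V -> 'rV[R]_n) (x v : V) (df : 'rV[R]_n) :
  is_derive x v f df -> is_derive x v (fun y => dot q (f y)) (dot q df).
Proof.
move=> /is_derive_row fx.
have -> : (fun y => dot q (f y)) =
    \sum_(i < n) (q ord0 i \*: (fun y => f y ord0 i)).
  by apply/funext => y; rewrite fct_sumE.
by apply: is_derive_sum => i; exact: is_deriveZ.
Qed.

Lemma is_derive_chain (R : realType) (V W : normedModType R) (g : V -> W)
    (f : R -> V) (t : R) (df : V) :
  is_derive t 1 f df -> differentiable g (f t) ->
  is_derive t 1 (g \o f) ('D_df g (f t)).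
Proof.
move=> [/derivable1_diffP dft fE] dg.
have dgf : differentiable (g \o f) t by exact: differentiable_comp.
split; first exact/derivable1_diffP.
rewrite (deriveE _ dgf) (deriveE _ dg) (diff_comp dft dg) -fE.
by rewrite (deriveE _ dft).
Qed.

(** * Gradients of affine functions and of the Lagrangian *)

Lemma dot_delta (R : realType) (n : nat) (q : 'rV[R]_n) i :
  dot q (delta_mx ord0 i) = q ord0 i.
Proof.
rewrite /dot (bigD1 i)//= big1 => [|j ji]; rewrite mxE eqxx /=.
  by rewrite eqxx mulr1 addr0.
by rewrite (negbTE ji) mulr0.
Qed.

Lemma dot_mulmx (R : realType) (n m : nat) (nu : 'rV[R]_m) (v : 'rV[R]_n)
    (A : 'M[R]_(n, m)) : dot nu (v *m A) = dot (nu *m A^T) v.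
Proof.
rewrite /dot.
under eq_bigr do rewrite mxE big_distrr/=.
rewrite exchange_big; apply: eq_bigr => i _; rewrite mxE big_distrl/=.
by apply: eq_bigr => j _; rewrite mxE -mulrA [v _ _ * _]mulrC.
Qed.

(** The Hamiltonian is affine in the velocity and in the control separately, so
    this computes both of the partial gradients that matter. *)
Lemma grad_affine (R : realType) (n : nat) (c : R) (q x : 'rV[R]_n) :
  grad (fun z => c + dot q z) x = q.
Proof.
apply/rowP => i; rewrite mxE -dot_delta -[RHS]add0r; apply: derive_val.
exact: is_deriveD (is_derive_cst _ _ _) (is_derive_dot _ (is_derive_id _ _)).
Qed.

Lemma grad_lagrangian (R : realType) (Nx Ne : nat) (E : 'rV[R]_Nx -> R)
    (e : 'rV[R]_Nx -> 'rV[R]_Ne) (nu0 : R) (nu : 'rV[R]_Ne) (x : 'rV[R]_Nx) :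
  differentiable E x -> differentiable e x ->
  grad (lagrangianN E e nu0 nu) x =
  nu0 *: grad E x + nu *m (jacobian e x)^T.
Proof.
move=> dE de; apply/rowP => i.
rewrite ![in LHS]mxE -[in RHS]dot_delta.
have -> : dot (nu0 *: grad E x + nu *m (jacobian e x)^T) (delta_mx ord0 i) =
    nu0 * 'D_(delta_mx ord0 i) E x + dot nu ('D_(delta_mx ord0 i) e x).
  by rewrite deriveEjacobian// dot_mulmx !dot_delta !mxE.
apply: derive_val; apply: (is_deriveD (f := nu0 \*: E)).
  by apply: is_deriveZ; apply/derivableP/diff_derivable.
by apply: is_derive_dot; apply/derivableP/diff_derivable.
Qed.

(** * Differential equations in integral form *)

Section ode_theory.
Context (R : realType) (a b : R) (ab : a < b).

Lemma ode_continuous (f g : R -> R) :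
  ode a b f g -> {within `[a, b], continuous f}.
Proof.
move=> [ig fE].
have := parameterized_integral_continuous (ltW ab) ig.
move=> /subspace_continuousP ic; apply/subspace_continuousP => t tab.
have tab' : t \in `[a, b] by [].
suff : f r @[r --> within `[a, b] (nbhs t)] --> f t by [].
rewrite (fE t tab').
have : f a + parameterized_integral lebesgue_measure a r g
    @[r --> within `[a, b] (nbhs t)] -->
    f a + parameterized_integral lebesgue_measure a t g.
  by apply: cvgD; [exact: cvg_cst|exact: ic].
apply: cvg_trans; apply: near_eq_cvg; rewrite near_withinE.
by apply: nearW => r rab; rewrite (fE r rab).
Qed.

Lemma ode_row_continuous (n : nat) (f g : R -> 'rV[R]_n) :
  ode_row a b f g -> {within `[a, b], continuous f}.
Proof.
move=> fg; apply/subspace_continuousP => t tab; apply/row_cvg => i.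
by have /ode_continuous/subspace_continuousP := fg i; exact.
Qed.

Lemma ode_is_derive (f g : R -> R) (t : R) :
  ode a b f g -> {within `[a, b], continuous g} -> t \in `]a, b[ ->
  is_derive t 1 f (g t).
Proof.
move=> [ig fE] cg tab.
have gt : {for t, continuous g} := within_continuous_continuous ab cg tab.
have [at_ tb] : a < t /\ t < b by move: tab; rewrite in_itv => /andP.
have [dI IE] := continuous_FTC1_closed tb ig at_ gt.
apply: (@near_eq_is_derive _ _ _ (cst (f a) +
  fun x => \int[lebesgue_measure]_(r in `[a, x]) g r)).
  near=> r; rewrite [RHS]fE//.
  by apply: subset_itv_oo_cc; near: r; exact: near_in_itvoo.
rewrite -[g t]add0r; apply: is_deriveD.
split; first exact: dI.
by rewrite -derive1E; exact: IE.
Unshelve. all: by end_near. Qed.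

(** The integral form gives no two-sided derivative at [b], so the right-hand
    side is shown to vanish in the interior and its value at [b] is the left
    limit. *)
Lemma ode_cst_rhs_end (f g : R -> R) (c : R) :
  ode a b f g -> {within `[a, b], continuous g} ->
  (forall t, t \in `[a, b] -> f t = c) -> g b = 0.
Proof.
move=> fg cg fc.
have g0 t : t \in `]a, b[ -> g t = 0.
  move=> tab; have [_ <-] := ode_is_derive fg cg tab.
  rewrite -(derive_cst (c : R) t 1); apply: near_eq_derive.
  near=> r; apply: fc.
  by apply: subset_itv_oo_cc; near: r; exact: near_in_itvoo.
have [_ _ gb] := (continuous_within_itvP _ ab).1 cg.
apply: (cvg_unique _ gb); first exact: Rhausdorff.
apply: cvg_near_cst; near=> r; apply: g0.
rewrite in_itv/=; apply/andP.
by split; near: r; [exact: nbhs_left_gt|exact: nbhs_left_lt].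
Unshelve. all: by end_near. Qed.

Lemma ode_increment (f F g : R -> R) :
  ode a b f g -> {within `[a, b], continuous g} ->
  {within `[a, b], continuous F} ->
  (forall t, t \in `]a, b[ -> is_derive t 1 F (g t)) ->
  f b - f a = F b - F a.
Proof.
move=> [ig fE] cg cF dF.
have [_ Fa Fb] := (continuous_within_itvP _ ab).1 cF.
rewrite fE ?in_itv/= ?(ltW ab) ?lexx// addrC addKr /Rintegral.
rewrite (@continuous_FTC2 _ g F)//.
  by split=> // t /dF[].
by move=> t /dF; rewrite derive1E => -[].
Qed.

End ode_theory.

(** * Extremals of Problem (M) *)

Section extremal.
Context (R : realType) (Nx Ne : nat) (E : 'rV[R]_Nx -> R)
  (e : 'rV[R]_Nx -> 'rV[R]_Ne) (t0 : R) (p : process R Nx Ne)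
  (l : costate R Nx Ne).

Lemma dHuE t : dHu E e p l t = lv l t.
Proof.
have HE : hamiltonian E e (lx l t) (lv l t) (ly l t) (ls l t)
    (px p t) (pv p t) (py p t) (ps p t) =
  fun z => (dot (lx l t) (pv p t) + ly l t * dot (grad E (px p t)) (pv p t) +
    dot (ls l t) (pv p t *m jacobian e (px p t))) + dot (lv l t) z.
  apply/funext => z; rewrite /hamiltonian -!addrA; congr (_ + _).
  by rewrite addrC addrA.
by rewrite /dHu /= HE grad_affine.
Qed.

Lemma dHvE t : dHv E e p l t =
  lx l t + ly l t *: grad E (px p t) + ls l t *m (jacobian e (px p t))^T.
Proof.
have HE : (fun z => hamiltonian E e (lx l t) (lv l t) (ly l t) (ls l t)
    (px p t) z (py p t) (ps p t) (pu p t)) =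
  fun z => dot (lv l t) (pu p t) + dot (lx l t + ly l t *: grad E (px p t) +
    ls l t *m (jacobian e (px p t))^T) z.
  apply/funext => z; rewrite /hamiltonian dot_mulmx.
  have dotD q r : dot (q + r) z = dot q z + dot r z.
    by rewrite /dot -big_split/=; apply: eq_bigr => i _; rewrite mxE mulrDl.
  have dotZ c q : dot (c *: q) z = c * dot q z.
    by rewrite /dot big_distrr/=; apply: eq_bigr => i _; rewrite mxE mulrA.
  by rewrite !dotD dotZ -!addrA addrCA.
by rewrite /dHv /= HE grad_affine.
Qed.

Context (t0f : t0 < tf p).

(** Both [s] and [e \o x] have derivative [v *m 'J e x], which is continuous
    because [v], itself the integral of the control, is; hence both have the
    integral of that function as their increment. *)
Lemma ps_tfE :
  (forall x, differentiable e x) -> continuous (jacobian e) ->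
  dynamics_M E e t0 p -> ps p t0 = e (px p t0) ->
  ps p (tf p) = e (px p (tf p)).
Proof.
move=> de cJ [dx dv _ ds] s0; apply/rowP => j.
have cx := ode_row_continuous t0f dx.
have cv := ode_row_continuous t0f dv.
have cg : {within `[t0, tf p],
    continuous (fun t => pv p t *m jacobian e (px p t))}.
  apply/subspace_continuousP => t tab; apply: cvg_mulmx.
    by move/subspace_continuousP : cv; exact.
  by have /subspace_continuousP := within_comp cx cJ; exact.
apply: (addIr (- ps p t0 ord0 j)); rewrite [in RHS]s0.
apply: (ode_increment (F := fun t => e (px p t) ord0 j) t0f (ds j)).
- apply: (within_comp cg (g := fun v : 'rV[R]_Ne => v ord0 j)).
  exact: coord_continuous.
- apply: (within_comp (within_comp cx (g := e) _)
    (g := fun v : 'rV[R]_Ne => v ord0 j)); last exact: coord_continuous.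
  by move=> x; exact: differentiable_continuous.
- move=> t tab.
  suff /is_derive_row/(_ j) : is_derive t 1 (e \o px p)
    (pv p t *m jacobian e (px p t)) by [].
  rewrite -(deriveEjacobian _ (de (px p t))).
  apply: (is_derive_chain _ (de (px p t))).
  apply/is_derive_row => i.
  apply: (ode_is_derive t0f (dx i)) => //.
  apply: (within_comp cv (g := fun v : 'rV[R]_Nx => v ord0 i)).
  exact: coord_continuous.
Qed.

(** Since [lv = d_u H = 0], the adjoint equation for [lv] has a constant
    solution; its right-hand side [- d_v H] is continuous and so vanishes up to
    the final time. *)
Lemma dHv_tf_eq0 :
  continuous (grad E) -> continuous (jacobian e) ->
  dynamics_M E e t0 p -> adjoint_M E e t0 p l ->
  hamiltonian_stationary_M E e t0 p l -> dHv E e p l (tf p) = 0.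
Proof.
move=> cG cJ [dx _ _ _] [alx alv aly als] hu.
have cx := ode_row_continuous t0f dx.
have clx := ode_row_continuous t0f alx.
have cly := ode_continuous t0f aly.
have cls := ode_row_continuous t0f als.
have cH : {within `[t0, tf p], continuous (dHv E e p l)}.
  rewrite (_ : dHv E e p l = fun t => lx l t + ly l t *: grad E (px p t) +
    ls l t *m (jacobian e (px p t))^T); last by apply/funext => t; exact: dHvE.
  apply/subspace_continuousP => t tab; apply: cvgD; first apply: cvgD.
  - by move/subspace_continuousP : clx; exact.
  - apply: cvgZ; first by move/subspace_continuousP : cly; exact.
    by have /subspace_continuousP := within_comp cx cG; exact.
  - apply: cvg_mulmx; first by move/subspace_continuousP : cls; exact.
    have /subspace_continuousP :=
      within_comp (within_comp cx cJ) (@trmx_continuous _ _ _).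
    exact.
have cN i : continuous (fun v : 'rV[R]_Nx => (- v) ord0 i).
  move=> v; apply: (continuous_comp (opp_continuous v)
    (g := fun w : 'rV[R]_Nx => w ord0 i)).
  exact: coord_continuous.
have cHi i : {within `[t0, tf p],
    continuous (fun t => (- dHv E e p l t) ord0 i)}.
  exact: within_comp cH (cN i).
have lv0 i t : t \in `[t0, tf p] -> lv l t ord0 i = 0.
  by move=> /hu; rewrite dHuE => ->; rewrite mxE.
apply: oppr_inj; rewrite oppr0; apply/rowP => i; rewrite [RHS]mxE.
exact: (ode_cst_rhs_end t0f (alv i) (cHi i) (lv0 i)).
Qed.

End extremal.

Theorem theorem2p5 (R : realType) (Nx Ne : nat)
    (E : 'rV[R]_Nx -> R) (e : 'rV[R]_Nx -> 'rV[R]_Ne)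
    (eL eU : 'rV[R]_Ne) (x0 : 'rV[R]_Nx) (t0 : R)
    (hE : twice_diff_fun E) (he : twice_diff_map e)
    (p : process R Nx Ne) (l : costate R Nx Ne)
    (nu0 : R) (nuv : 'rV[R]_Nx) (nus : 'rV[R]_Ne)
    (hp : feasible_M E e eL eU x0 t0 p)
    (hadj : adjoint_M E e t0 p l)
    (hu : hamiltonian_stationary_M E e t0 p l)
    (htr : transversality_M eL eU p l nu0 nuv nus) :
  first_order_N E e eL eU nu0 nus (px p (tf p)).
Proof.
have cG : continuous (grad E).
  by move=> x; apply: differentiable_continuous; have [] := hE x.
have cJ : continuous (jacobian e).
  by move=> x; apply: differentiable_continuous; have [] := he x.
case: hp => t0f dyn [px0 _ ps0] _ sbnd.
case: htr => lxf _ [lyf nu0_ge0] lsf compl.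
have sf : ps p (tf p) = e (px p (tf p)).
  by apply: (ps_tfE t0f _ cJ dyn) => [x|]; [have [] := he x|rewrite px0].
have dEf : differentiable E (px p (tf p)) by have [] := hE (px p (tf p)).
have def : differentiable e (px p (tf p)) by have [] := he (px p (tf p)).
rewrite sf in sbnd compl; split=> //.
rewrite grad_lagrangian//.
by have := dHv_tf_eq0 t0f cG cJ dyn hadj hu; rewrite dHvE lxf lyf lsf add0r.
Qed.
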